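(* Let $\mathcal S=(\mathcal S_j)_{0\le j\le J}$ be a martingale with respect to $(\mathcal F_j)$ with $\mathcal S_0=0$, and let $M=M^{\star}-\mathcal S$. The following hold. (i) $M\in\mathcal M^{\circ,0}$ if and only if, almost surely, $$\max_{0\le r<j}\left(Z_r-Y_r^{\star}-\mathcal S_j+\mathcal S_r\right)\le 0\quad\text{for } 0\le j\le\tau^{\star},$$ and $$\mathcal S_j-\mathcal S_{\tau^{\star}}\le Y_j^{\star}-Z_j+A_j^{\star}\quad\text{for }\tau^{\star}<j\le J,$$ where $A_j^{\star}=0$ for all $0\le j\le\tau^{\star}$. (ii) $M\in\mathcal M^{\circ\circ,0}$ if and only if, almost surely, $$\mathcal S_j=0\quad\text{for }0\le j\le\tau^{\star},$$ and $$\mathcal S_j\le Y_j^{\star}-Z_j+A_j^{\star}\quad\text{for }\tau^{\star}<j\le J.$$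
   Context: $J\in\mathbb N_+$; $(\Omega,\mathcal F,\mathsf P)$ is a probability space with discrete filtration $(\mathcal F_j)_{0\le j\le J}$; $\mathsf E_{\mathcal F_j}$ denotes conditional expectation given $\mathcal F_j$. The reward process $Z=(Z_j)_{0\le j\le J}$ is real-valued, adapted and integrable. The Snell envelope is $Y_j^{\star}=\operatorname{ess\,sup}_{\tau\in\mathcal T[j,\ldots,J]}\mathsf E_{\mathcal F_j}[Z_\tau]$, where $\mathcal T[j,\ldots,J]$ is the set of stopping times with values in $\{j,\ldots,J\}$. Its Doob decomposition is $Y_j^{\star}=Y_0^{\star}+M_j^{\star}-A_j^{\star}$ with $M^{\star}_j=\sum_{l=1}^{j}\left(Y_l^{\star}-\mathsf E_{\mathcal F_{l-1}}[Y_l^{\star}]\right)$ (the Doob martingale, $M_0^\star=0$) and $A_j^{\star}=\sum_{l=1}^{j}\left(Y_{l-1}^{\star}-\mathsf E_{\mathcal F_{l-1}}[Y_l^{\star}]\right)$ (predictable, non-decreasing, $A_0^\star=0$). $\mathcal M$ is the set of martingales $(M_j)_{0\le j\le J}$ with $M_0=0$. $\mathcal M^{\circ,0}$ is the set of $M\in\mathcal M$ with $Y_0^{\star}=\mathsf E_{\mathcal F_0}\left[\max_{0\le r\le J}(Z_r-M_r)\right]$ (weakly optimal at $0$). $\mathcal M^{\circ\circ,0}$ is the set of $M\in\mathcal M$ with $Y_0^{\star}=\max_{0\le r\le J}(Z_r-M_r)$ almost surely (surely optimal at $0$). $\tau^{\star}$ is the first optimal stopping time at $0$: $\tau^{\star}=\inf\{0\le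 i\le J: i=J\text{ or }Z_i\ge\mathsf E_{\mathcal F_i}[Y_{i+1}^{\star}]\}$. The maximum over an empty set is $-\infty$ (the case $j=0$ in (i) is void). *)

(* Defs.v *)
From HB Require Import structures.
From mathcomp Require Import all_boot all_order all_algebra.
From mathcomp Require Import all_classical all_reals all_analysis.
From mathcomp Require Import measurable_realfun.

Set Implicit Arguments.
Unset Strict Implicit.
Unset Printing Implicit Defensive.

Import Order.TTheory GRing.Theory Num.Theory.
Import numFieldNormedType.Exports.

Local Open Scope classical_set_scope.
Local Open Scope ring_scope.

(* Processes and filtrations indexed by {0, ..., J} are encoded as families
   indexed by nat; their members of index > J are unconstrained and never
   matter. *)

Section ConditionalExpectation.
Context (d : measure_display) (T : measurableType d) (R : realType).
Variable P : probability T R.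

Definition sub_measurable (G : set (set T)) (X : T -> R) : Prop :=
  measurable_fun setT (X : g_sigma_algebraType G -> R).

Definition integrable_rv (X : T -> R) : Prop :=
  P.-integrable setT (EFin \o X).

Record is_cond_exp (G : set (set T)) (X Y : T -> R) : Prop := IsCondExp {
  cond_exp_measurable : sub_measurable G Y ;
  cond_exp_integrable : integrable_rv Y ;
  cond_exp_integral : forall A, G A ->
    (\int[P]_(w in A) (Y w)%:E = \int[P]_(w in A) (X w)%:E)%E }.

(* A fixed version of the conditional expectation of X given G; the default
   value is irrelevant for integrable X, by cond_expP below. *)
Definition cond_exp (G : set (set T)) (X : T -> R) : T -> R :=
  xget (cst 0) [set Y | is_cond_exp G X Y].

Lemma cond_expP (G : set (set T)) (X : T -> R) :
  sigma_algebra setT G -> G `<=` measurable -> integrable_rv X ->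
  is_cond_exp G X (cond_exp G X).
Proof.
move=> sG Gm iX; apply: (xgetPex (cst 0)).
have GE A : measurable (A : set (g_sigma_algebraType G)) <-> G A.
  by rewrite measurable_g_measurableTypeE.
pose phi : T -> g_sigma_algebraType G := id.
have mphi : measurable_fun setT phi.
  by move=> _ A /GE /Gm mA; rewrite setTI.
have mphiA A : measurable A -> measurable (phi @^-1` A).
  by move=> /mphi -/(_ measurableT); rewrite setTI.
pose PG : probability (g_sigma_algebraType G) R :=
  distribution P (mfun_Sub (mem_set mphi)).
pose nu_of : {charge set (g_sigma_algebraType G) -> \bar R} :=
  pushforward (induced_charge iX) phi.
pose nu := nu_of mphi.
have nuP : nu `<< PG.
  apply/null_content_dominatesP => A mA PA0.
  apply: null_set_integral => //; first exact: mphiA.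
  exact: measurable_funTS (measurable_int _ iX).
have fin w : Radon_Nikodym nu PG w \is a fin_num.
  exact: (Radon_Nikodym_fin_num w nuP).
have intf := Radon_Nikodym_integrable nuP.
have mf := measurable_int _ intf.
pose Y : T -> R := fun w => fine (Radon_Nikodym nu PG w).
have YE : EFin \o Y = Radon_Nikodym nu PG \o phi.
  by apply/funext => w /=; rewrite fineK.
have iY : integrable_rv Y.
  rewrite /integrable_rv YE; apply/integrableP; split.
    exact: measurableT_comp mf mphi.
  have /integrableP[_] := intf.
  rewrite ge0_integral_pushforward //.
  exact: measurableT_comp mf.
exists Y; split => //.
  exact: measurableT_comp mf.
move=> A GA; have mA := (GE A).2 GA.
rewrite -[RHS]/(nu A) (Radon_Nikodym_integral nuP mA).
transitivity (\int[P]_(w in phi @^-1` A) (Radon_Nikodym nu PG \o phi) w)%E.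
  by apply: eq_integral => w _; rewrite -YE.
rewrite -integral_pushforward //.
by rewrite -YE; apply: integrableS iY => //; exact: mphiA.
Qed.

(* Y is a G-measurable version of the essential supremum of the family Phi. *)
Record is_ess_sup (G : set (set T)) (Phi : set (T -> R)) (Y : T -> R) : Prop :=
  IsEssSup {
  ess_sup_measurable : sub_measurable G Y ;
  ess_sup_ub : forall X, Phi X -> \forall w \ae P, X w <= Y w ;
  ess_sup_least : forall U : T -> \bar R, measurable_fun setT U ->
    (forall X, Phi X -> \forall w \ae P, ((X w)%:E <= U w)%E) ->
    \forall w \ae P, ((Y w)%:E <= U w)%E }.

(* The default value is irrelevant for the Snell envelope of an adapted
   integrable process: there the essential supremum is attained. *)
Definition family_ess_sup (G : set (set T)) (Phi : set (T -> R)) : T -> R :=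
  xget (cst 0) [set Y | is_ess_sup G Phi Y].

End ConditionalExpectation.

Section Processes.
Context (d : measure_display) (T : measurableType d) (R : realType).
Variables (P : probability T R) (J : nat) (F : nat -> set (set T)).
Implicit Types (X Y Z M : nat -> T -> R) (tau : T -> nat).

Record is_filtration : Prop := IsFiltration {
  filtration_sigma : forall j, (j <= J)%N -> sigma_algebra setT (F j) ;
  filtration_sub : forall j, (j <= J)%N -> F j `<=` measurable ;
  filtration_mono : forall i j, (i <= j <= J)%N -> F i `<=` F j }.

Definition adapted X : Prop := forall j, (j <= J)%N -> sub_measurable (F j) (X j).

Definition integrable_process X : Prop :=
  forall j, (j <= J)%N -> integrable_rv P (X j).

Definition stopped X tau : T -> R := fun w => X (tau w) w.

Definition stopping_time_in (j : nat) tau : Prop :=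
  (forall w, (j <= tau w <= J)%N) /\
  (forall i, (i <= J)%N -> F i [set w | (tau w <= i)%N]).

(* The essential supremum is only defined up to null sets; an F_j-measurable
   version is chosen so that the Snell envelope is an adapted process. *)
Definition snell Z (j : nat) : T -> R :=
  family_ess_sup P (F j)
    [set cond_exp P (F j) (stopped Z tau) | tau in stopping_time_in j].

Definition doob_martingale Y (j : nat) : T -> R := fun w =>
  \sum_(1 <= l < j.+1) (Y l w - cond_exp P (F l.-1) (Y l) w).

Definition doob_compensator Y (j : nat) : T -> R := fun w =>
  \sum_(1 <= l < j.+1) (Y l.-1 w - cond_exp P (F l.-1) (Y l) w).

Record is_martingale M : Prop := IsMartingale {
  martingale_adapted : adapted M ;
  martingale_integrable : integrable_process M ;
  martingale_cond_exp : forall i j, (i <= j <= J)%N ->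
    \forall w \ae P, cond_exp P (F i) (M j) w = M i w }.

Definition martingale0 M : Prop :=
  is_martingale M /\ \forall w \ae P, M 0%N w = 0.

(* Since the default value is the term r = 0, this is the maximum of
   Z_r - M_r over 0 <= r <= J. *)
Definition pathwise_max Z M : T -> R := fun w =>
  \big[Num.max/Z 0%N w - M 0%N w]_(0 <= r < J.+1) (Z r w - M r w).

Definition weakly_optimal Z M : Prop :=
  martingale0 M /\
  \forall w \ae P, snell Z 0 w = cond_exp P (F 0%N) (pathwise_max Z M) w.

Definition surely_optimal Z M : Prop :=
  martingale0 M /\ \forall w \ae P, snell Z 0 w = pathwise_max Z M w.

(* The minimum exists since i = J satisfies the condition; there the
   meaningless process snell at index J + 1 is not consulted. *)
Definition first_optimal Z : T -> nat := fun w =>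
  [arg min_(i < (ord_max : 'I_J.+1) |
     (i == J :> nat) || (cond_exp P (F i) (snell Z i.+1) w <= Z i w)%R) (i : nat)]%N.

End Processes.

(* Main.v *)
(* Write tau for the first optimal time and D_r = Y_r - Z_r + A_r >= 0. The Doob
   decomposition gives Z_r - M_r = Y_0 + S_r - D_r, while D_tau = 0 since A
   vanishes up to tau and Y_tau = Z_tau. Hence max_r (Z_r - M_r) dominates
   Y_0 + S_tau, whose F_0-conditional expectation is Y_0 by optional stopping.
   So M is weakly optimal iff this domination is an equality, that is,
   S_r - D_r <= S_tau for all r, and surely optimal iff moreover S_tau = 0. The
   conditions at times j before tau come from those at tau by conditioning on
   F_j, because S_j = E_j[S_(max tau j)].
   The dynamic programming equation for Y is obtained by proving that the
   backward recursion V_J = Z_J, V_j = max (Z_j, E_j[V_(j+1)]) is a version of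
   the essential supremum defining the Snell envelope. *)
Require Import Defs.
From mathcomp Require Import all_boot all_order all_algebra.
From mathcomp Require Import all_classical all_reals all_analysis.
From mathcomp Require Import measurable_realfun lra.
Import Order.TTheory GRing.Theory Num.Theory.
Local Open Scope classical_set_scope.
Local Open Scope ring_scope.

(** * Integration *)

Section Integration.
Context {d : measure_display} {T : measurableType d} {R : realType}.
Variable P : probability T R.
Implicit Types (X Y : T -> R) (D : set T).

Lemma integrable_rvS X D :
  integrable_rv P X -> measurable D -> P.-integrable D (EFin \o X).
Proof. by move=> iX mD; apply: integrableS iX. Qed.

Lemma integrable_rv_measurable X : integrable_rv P X -> measurable_fun setT X.
Proof. by move=> /measurable_int /measurable_EFinP. Qed.

Lemma integrable_rvD X Y : integrable_rv P X -> integrable_rv P Y ->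
  integrable_rv P (fun w => X w + Y w).
Proof. by move=> iX iY; exact: (integrableD measurableT iX iY). Qed.

Lemma integrable_rvB X Y : integrable_rv P X -> integrable_rv P Y ->
  integrable_rv P (fun w => X w - Y w).
Proof. by move=> iX iY; exact: (integrableB measurableT iX iY). Qed.

Lemma integrable_rv_max X Y : integrable_rv P X -> integrable_rv P Y ->
  integrable_rv P (fun w => Num.max (X w) (Y w)).
Proof.
move=> iX iY.
have iXY : integrable_rv P (fun w => `|X w| + `|Y w|).
  by apply: integrable_rvD; exact: integrable_norm.
apply: le_integrable iXY => //.
  apply/measurable_EFinP.
  by apply: measurable_maxr; exact: integrable_rv_measurable.
move=> w _ /=; rewrite lee_fin [leRHS]ger0_norm ?addr_ge0//.
by rewrite /Num.max; case: ifP => _; rewrite ?lerDl ?lerDr.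
Qed.

Lemma integrable_rv_bigmax (I : eqType) (s : seq I) X (f : I -> T -> R) :
  integrable_rv P X -> (forall i, i \in s -> integrable_rv P (f i)) ->
  integrable_rv P (fun w => \big[Num.max/X w]_(i <- s) f i w).
Proof.
move=> iX; elim: s => [|i s IH] ifs.
  by rewrite [Y in integrable_rv _ Y](_ : _ = X)//; apply/funext=> w;
    rewrite big_nil.
rewrite [Y in integrable_rv _ Y](_ : _ = fun w =>
    Num.max (f i w) (\big[Num.max/X w]_(j <- s) f j w)).
  apply: integrable_rv_max; first by apply: ifs; rewrite mem_head.
  by apply: IH => j js; apply: ifs; rewrite in_cons js orbT.
by apply/funext => w; rewrite big_cons.
Qed.

Lemma RintegralE X D : integrable_rv P X -> measurable D ->
  (\int[P]_(w in D) (X w)%:E = (\int[P]_(w in D) X w)%:E)%E.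
Proof.
by move=> iX mD; rewrite fineK//; apply: integrable_fin_num => //;
  exact: integrable_rvS.
Qed.

(** [Y - X] agrees almost everywhere on [D] with its absolute value, whose integral is
    non-negative. *)
Lemma ae_le_Rintegral X Y D :
  integrable_rv P X -> integrable_rv P Y -> measurable D ->
  (\forall w \ae P, D w -> X w <= Y w) ->
  \int[P]_(w in D) X w <= \int[P]_(w in D) Y w.
Proof.
move=> iX iY mD XY; rewrite -subr_ge0 -RintegralB//; try exact: integrable_rvS.
have iB := integrable_rvB _ _ iY iX.
rewrite -lee_fin -RintegralE//.
have mB := integrable_rv_measurable _ iB.
rewrite (ae_eq_integral (fun w => `|(Y w - X w)%:E|%E)) //.
- by apply: integral_ge0 => w _; exact: abse_ge0.
- by apply/measurable_EFinP; exact: measurable_funTS.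
- apply: measurableT_comp => //.
  by apply/measurable_EFinP; exact: measurable_funTS.
- apply: filterS XY => w XY Dw; rewrite /= ger0_norm// subr_ge0.
  exact: XY.
Qed.

Lemma ae_eq_Rintegral X Y D :
  integrable_rv P X -> integrable_rv P Y -> measurable D ->
  (\forall w \ae P, X w = Y w) ->
  \int[P]_(w in D) X w = \int[P]_(w in D) Y w.
Proof.
move=> iX iY mD XY; apply/eqP; rewrite eq_le.
by apply/andP; split; apply: ae_le_Rintegral => //;
  apply: filterS XY => w ->.
Qed.

(** The integral of [|Y - X|] over [D] is the difference of the two integrals, hence zero. This
    rigidity turns equality of expectations into pathwise identities. *)
Lemma ae_eq_of_le_Rintegral X Y D :
  integrable_rv P X -> integrable_rv P Y -> measurable D ->
  (\forall w \ae P, D w -> X w <= Y w) ->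
  \int[P]_(w in D) Y w <= \int[P]_(w in D) X w ->
  \forall w \ae P, D w -> X w = Y w.
Proof.
move=> iX iY mD XY YX.
have iB := integrable_rvB _ _ iY iX.
have mB : measurable_fun D (EFin \o (fun w => Y w - X w)).
  apply/measurable_EFinP; apply: measurable_funTS.
  exact: integrable_rv_measurable.
have : (\int[P]_(w in D) `|(EFin \o (fun w => Y w - X w)%R) w| = 0)%E.
  transitivity (\int[P]_(w in D) (Y w - X w)%:E)%E; last first.
    rewrite RintegralE// RintegralB//; try exact: integrable_rvS.
    congr (_%:E); apply/eqP; rewrite subr_eq0 eq_le YX/=.
    exact: ae_le_Rintegral.
  apply: ae_eq_integral => //.
    by apply: measurableT_comp.
  apply: filterS XY => w XY Dw /=; rewrite ger0_norm// subr_ge0.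
  exact: XY.
move/(ae_eq_integral_abs _ mD mB); apply: filterS => w YX0 /YX0 /= [] /eqP.
by rewrite subr_eq0 => /eqP ->.
Qed.

Lemma ae_eq_integrable_rv X Y : integrable_rv P X -> measurable_fun setT Y ->
  (\forall w \ae P, X w = Y w) -> integrable_rv P Y.
Proof.
move=> /integrableP[mX iX] mY XY; apply/integrableP; split.
  exact/measurable_EFinP.
rewrite (ae_eq_integral (fun w => `|(X w)%:E|%E))//.
- by do 2!apply: measurableT_comp => //.
- by apply: measurableT_comp.
- by apply: filterS XY => w XY _ /=; rewrite XY.
Qed.

End Integration.

(** * Conditional expectation *)

Section SubSigmaAlgebra.
Context {d : measure_display} {T : measurableType d} {R : realType}.
Variables (P : probability T R) (G : set (set T)).
Hypotheses (sG : sigma_algebra setT G) (Gm : G `<=` measurable).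
Implicit Types (X Y : T -> R) (D : set T).

Lemma measurable_sub D :
  measurable (D : set (g_sigma_algebraType G)) <-> G D.
Proof. by rewrite measurable_g_measurableTypeE. Qed.

Lemma sub_setI (A B : set T) : G A -> G B -> G (A `&` B).
Proof.
by move=> /measurable_sub GA /measurable_sub GB; apply/measurable_sub;
  exact: measurableI.
Qed.

Lemma sub_setC (A : set T) : G A -> G (~` A).
Proof.
by move=> /measurable_sub GA; apply/measurable_sub; exact: measurableC.
Qed.

Lemma sub_measurableW X : sub_measurable G X -> measurable_fun setT X.
Proof. by move=> mX _ B mB; apply/Gm/measurable_sub; exact: mX. Qed.

Lemma sub_measurable_le X Y : sub_measurable G X -> sub_measurable G Y ->
  G [set w | X w <= Y w].
Proof.
move=> mX mY; apply/measurable_sub.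
have := measurable_fun_ler mX mY => /(_ measurableT [set true]).
by rewrite setTI; apply.
Qed.

(* Comparing the integrals of two G-measurable functions over the sets of G is
   enough, since the set where the inequality fails belongs to G. *)
Lemma ae_le_of_Rintegral X Y (B : set T) :
  sub_measurable G X -> sub_measurable G Y ->
  integrable_rv P X -> integrable_rv P Y -> G B ->
  (forall D, G D -> D `<=` B ->
    \int[P]_(w in D) X w <= \int[P]_(w in D) Y w) ->
  \forall w \ae P, B w -> X w <= Y w.
Proof.
move=> mX mY iX iY GB XY.
pose D := B `&` ~` [set w | X w <= Y w].
have GD : G D.
  by apply: sub_setI => //; apply: sub_setC; exact: sub_measurable_le.
have XgtY w : D w -> Y w < X w by case=> _ /negP; rewrite -ltNge.
have DB : D `<=` B by move=> w [].
have := @ae_eq_of_le_Rintegral _ _ _ P _ _ D iY iX (Gm _ GD).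
move=> /(_ _ (XY _ GD DB)) YX.
have : \forall w \ae P, D w -> Y w = X w.
  by apply: YX; apply: aeW => w /XgtY /ltW.
apply: filterS => w YXw Bw; rewrite leNgt; apply/negP => ltYX.
have Dw : D w by split => //; apply/negP; rewrite -ltNge.
by move: ltYX; rewrite (YXw Dw) ltxx.
Qed.

Lemma is_cond_exp_Rintegral X Y D : is_cond_exp P G X Y -> G D ->
  \int[P]_(w in D) Y w = \int[P]_(w in D) X w.
Proof. by move=> [_ _ XY] GD; rewrite /Rintegral XY. Qed.

Lemma is_cond_expP X Y : integrable_rv P X -> integrable_rv P Y ->
  sub_measurable G Y ->
  (forall D, G D -> \int[P]_(w in D) Y w = \int[P]_(w in D) X w) ->
  is_cond_exp P G X Y.
Proof.
move=> iX iY mY XY; split=> // D GD.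
by rewrite !RintegralE ?XY//; exact: Gm.
Qed.

Lemma is_cond_exp_id X : integrable_rv P X -> sub_measurable G X ->
  is_cond_exp P G X X.
Proof. by move=> iX mX; exact: is_cond_expP. Qed.

(** [G] need not contain the null sets, so measurability of the new version [Y'] is a hypothesis of
    its own. *)
Lemma is_cond_exp_ae X Y Y' : integrable_rv P Y' -> sub_measurable G Y' ->
  is_cond_exp P G X Y -> (\forall w \ae P, Y w = Y' w) ->
  is_cond_exp P G X Y'.
Proof.
move=> iY' mY' [mY iY XY] YY'; split => // D GD; rewrite -XY//.
have mD := Gm _ GD.
by rewrite !RintegralE//; congr (_%:E); apply/esym; exact: ae_eq_Rintegral.
Qed.

Lemma is_cond_expD X X' Y Y' : integrable_rv P X -> integrable_rv P X' ->
  is_cond_exp P G X Y -> is_cond_exp P G X' Y' ->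
  is_cond_exp P G (fun w => X w + X' w) (fun w => Y w + Y' w).
Proof.
move=> iX iX' XY XY'; have [mY iY _] := XY; have [mY' iY' _] := XY'.
apply: is_cond_expP; [exact: integrable_rvD..|exact: measurable_funD|].
move=> D GD; have mD := Gm _ GD.
rewrite !RintegralD//; try exact: integrable_rvS.
by rewrite (is_cond_exp_Rintegral _ _ _ XY)// (is_cond_exp_Rintegral _ _ _ XY').
Qed.

Lemma is_cond_expB X X' Y Y' : integrable_rv P X -> integrable_rv P X' ->
  is_cond_exp P G X Y -> is_cond_exp P G X' Y' ->
  is_cond_exp P G (fun w => X w - X' w) (fun w => Y w - Y' w).
Proof.
move=> iX iX' XY XY'; have [mY iY _] := XY; have [mY' iY' _] := XY'.
apply: is_cond_expP; [exact: integrable_rvB..|exact: measurable_funB|].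
move=> D GD; have mD := Gm _ GD.
rewrite !RintegralB//; try exact: integrable_rvS.
by rewrite (is_cond_exp_Rintegral _ _ _ XY)// (is_cond_exp_Rintegral _ _ _ XY').
Qed.

(** Testing on the sets of [G] inside [B] suffices. The localised form serves events such as
    [j <= tau] without multiplying by indicators. *)
Lemma is_cond_exp_local_le X X' Y Y' (B : set T) :
  integrable_rv P X -> integrable_rv P X' ->
  is_cond_exp P G X Y -> is_cond_exp P G X' Y' -> G B ->
  (\forall w \ae P, B w -> X w <= X' w) ->
  \forall w \ae P, B w -> Y w <= Y' w.
Proof.
move=> iX iX' XY XY' GB leX; have [mY iY _] := XY; have [mY' iY' _] := XY'.
apply: ae_le_of_Rintegral => // D GD DB.
rewrite (is_cond_exp_Rintegral _ _ _ XY)// (is_cond_exp_Rintegral _ _ _ XY')//.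
apply: ae_le_Rintegral => //; first exact: Gm.
by apply: filterS leX => w leX /DB.
Qed.

Lemma is_cond_exp_local_eq X X' Y Y' (B : set T) :
  integrable_rv P X -> integrable_rv P X' ->
  is_cond_exp P G X Y -> is_cond_exp P G X' Y' -> G B ->
  (\forall w \ae P, B w -> X w = X' w) ->
  \forall w \ae P, B w -> Y w = Y' w.
Proof.
move=> iX iX' XY XY' GB eqX.
have le1 : \forall w \ae P, B w -> Y w <= Y' w.
  apply: (is_cond_exp_local_le X X') => //.
  by apply: filterS eqX => w eqX /eqX ->.
have le2 : \forall w \ae P, B w -> Y' w <= Y w.
  apply: (is_cond_exp_local_le X' X) => //.
  by apply: filterS eqX => w eqX /eqX ->.
by apply: filterS2 le1 le2 => w h1 h2 Bw; apply/eqP; rewrite eq_le h1// h2.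
Qed.

(** Contains the almost sure uniqueness of conditional expectations, by which the chosen version
    [cond_exp] is exchanged for explicit ones. *)
Lemma is_cond_exp_ae_eq X X' Y Y' :
  integrable_rv P X -> integrable_rv P X' ->
  is_cond_exp P G X Y -> is_cond_exp P G X' Y' ->
  (\forall w \ae P, X w = X' w) -> \forall w \ae P, Y w = Y' w.
Proof.
move=> iX iX' XY XY' eqX.
have := @is_cond_exp_local_eq X X' Y Y' setT iX iX' XY XY'.
have GT : G setT by apply/measurable_sub; exact: measurableT.
move=> /(_ GT) h; have : \forall w \ae P, setT w -> Y w = Y' w.
  by apply: h; apply: filterS eqX.
by apply: filterS => w; apply.
Qed.

End SubSigmaAlgebra.

(** * Stopping times *)

Section Filtration.
Context {d : measure_display} {T : measurableType d} {R : realType}.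
Variables (P : probability T R) (J : nat) (F : nat -> set (set T)).
Hypothesis hF : is_filtration J F.
Implicit Types (X Y Z M : nat -> T -> R) (tau : T -> nat).

Lemma filtration_sub_measurable i j (X : T -> R) : (i <= j <= J)%N ->
  sub_measurable (F i) X -> sub_measurable (F j) X.
Proof.
move=> /andP[ij jJ] mX mT B mB.
apply/(measurable_sub (F j)); first exact: (filtration_sigma hF jJ).
apply: (filtration_mono hF (i := i)); first by rewrite ij.
apply/(measurable_sub (F i)); last exact: mX.
by apply: (filtration_sigma hF); exact: leq_trans jJ.
Qed.

Lemma cond_exp_filtrationP j (X : T -> R) : (j <= J)%N -> integrable_rv P X ->
  is_cond_exp P (F j) X (cond_exp P (F j) X).
Proof.
move=> jJ; apply: cond_expP; first exact: (filtration_sigma hF).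
exact: (filtration_sub hF).
Qed.

Lemma stopping_time_gt j tau i : stopping_time_in J F j tau -> (i <= J)%N ->
  F i [set w | (i < tau w)%N].
Proof.
move=> [_ /(_ i) mtau] iJ.
have -> : [set w | (i < tau w)%N] = ~` [set w | (tau w <= i)%N].
  by apply/seteqP; split=> w /=; rewrite ltnNge => /negP.
by apply: sub_setC; [exact: (filtration_sigma hF)|exact: mtau].
Qed.

(** * Gluing along an event and optional stopping *)

Lemma integrable_rv_piecewise (X Y Z : T -> R) (D : set T) :
  integrable_rv P X -> integrable_rv P Y -> measurable D ->
  (forall w, D w -> Z w = X w) -> (forall w, ~ D w -> Z w = Y w) ->
  integrable_rv P Z.
Proof.
move=> iX iY mD ZX ZY; rewrite /integrable_rv.
have -> : EFin \o Z = (((EFin \o X) \_ D) \+ ((EFin \o Y) \_ (~` D)))%E.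
  apply/funext => w; rewrite /patch /= in_setC.
  case: ifPn => [/set_mem Dw|/negP Dw] /=; first by rewrite ZX// adde0.
  by rewrite ZY ?add0e// => /mem_set.
have mDC := measurableC mD.
by apply: integrableD => //; apply/(integrable_mkcond (_ \o _)) => //;
  exact: integrable_rvS.
Qed.

Lemma Rintegral_piecewise (X Y Z : T -> R) (A D : set T) :
  integrable_rv P X -> integrable_rv P Y -> measurable A -> measurable D ->
  (forall w, D w -> Z w = X w) -> (forall w, ~ D w -> Z w = Y w) ->
  \int[P]_(w in A) Z w =
  \int[P]_(w in A `&` D) X w + \int[P]_(w in A `&` ~` D) Y w.
Proof.
move=> iX iY mA mD ZX ZY.
have iZ := integrable_rv_piecewise _ _ _ _ iX iY mD ZX ZY.
have mDC := measurableC mD.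
rewrite -{1}(setIT A) -(setUv D) setIUr Rintegral_setU.
- congr (_ + _); apply: eq_Rintegral => w /set_mem[_ ?]; [exact: ZX|exact: ZY].
- exact: measurableI.
- exact: measurableI.
- by apply: integrable_rvS => //; apply: measurableU; exact: measurableI.
- by apply/disj_setPS => w [[_ ?] [_]].
Qed.

Lemma stopped_minnS X tau k w :
  ((tau w <= k)%N -> X (minn (tau w) k.+1) w = X (minn (tau w) k) w) /\
  (~ (tau w <= k)%N -> X (minn (tau w) k.+1) w = X k.+1 w).
Proof.
split=> [tk|/negP]; last by rewrite -ltnNge => /minn_idPr ->.
by rewrite !(minn_idPl _) // ltnW.
Qed.

Lemma integrable_stopped_minn X tau j k : integrable_process P J X ->
  stopping_time_in J F j tau -> (k <= J)%N ->
  integrable_rv P (fun w => X (minn (tau w) k) w).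
Proof.
move=> iX [tauJ mtau]; elim: k => [|k IH] kJ.
  have -> : (fun w => X (minn (tau w) 0) w) = X 0%N.
    by apply/funext => w; rewrite minn0.
  exact: iX.
apply: (integrable_rv_piecewise _ _ _ _ (IH (ltnW kJ)) (iX _ kJ)).
- by apply: (filtration_sub hF (ltnW kJ)); apply: mtau; exact: ltnW.
- by move=> w /(stopped_minnS X tau k w).1.
- by move=> w /(stopped_minnS X tau k w).2.
Qed.

Lemma stoppedE X tau j : stopping_time_in J F j tau ->
  stopped X tau = fun w => X (minn (tau w) J) w.
Proof.
move=> [tauJ _]; apply/funext => w; rewrite /stopped.
by have /andP[_ /minn_idPl ->] := tauJ w.
Qed.

Lemma integrable_stopped X tau j : integrable_process P J X ->
  stopping_time_in J F j tau -> integrable_rv P (stopped X tau).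
Proof.
move=> iX st; rewrite (stoppedE _ _ _ st).
exact: integrable_stopped_minn st _.
Qed.

(** The two stopped values agree where [tau <= k]. The remaining part [B] of [A] lies in [F k], so
    there [X k.+1] may be replaced by its conditional expectation. *)
Lemma Rintegral_stopped_minnS X tau j k (A : set T) :
  integrable_process P J X -> stopping_time_in J F j tau ->
  (j <= k < J)%N -> F j A ->
  let B := A `&` [set w | (k < tau w)%N] in
  \int[P]_(w in A) X (minn (tau w) k.+1) w =
  \int[P]_(w in A) X (minn (tau w) k) w +
  (\int[P]_(w in B) cond_exp P (F k) (X k.+1) w - \int[P]_(w in B) X k w).
Proof.
move=> iX st /andP[jk kJ] FA B; have [tauJ mtau] := st.
have jJ : (j <= J)%N by rewrite (leq_trans jk)// ltnW.
have mA : measurable A by exact: (filtration_sub hF jJ).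
have FD := mtau _ (ltnW kJ).
have mD := filtration_sub hF (ltnW kJ) FD.
have ik := integrable_stopped_minn _ _ _ _ iX st (ltnW kJ).
rewrite (Rintegral_piecewise _ _ _ _ _ ik (iX _ kJ) mA mD); last 2 first.
- by move=> w /(stopped_minnS X tau k w).1.
- by move=> w /(stopped_minnS X tau k w).2.
rewrite (Rintegral_piecewise _ _ (fun w => X (minn (tau w) k) w) _ _ ik
  (iX _ (ltnW kJ)) mA mD) //; last first.
  by move=> w /negP; rewrite -ltnNge => /ltnW /minn_idPr ->.
have -> : ~` [set w | (tau w <= k)%N] = [set w | (k < tau w)%N].
  by apply/seteqP; split=> w /=; rewrite ltnNge => /negP.
have FB : F k B.
  apply: (sub_setI _ (filtration_sigma hF (ltnW kJ))).
    by apply: (filtration_mono hF (i := j)) => //; rewrite jk ltnW.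
  exact: stopping_time_gt st (ltnW kJ).
rewrite (is_cond_exp_Rintegral _ _ _ _ _
  (cond_exp_filtrationP _ _ (ltnW kJ) (iX _ kJ)))//.
by rewrite -/B -addrA [X in _ = _ + X]addrC subrK.
Qed.

(** Each one-step increment of the truncated integrals is non-positive, by the supermartingale
    inequality before [tau]; truncation at [J] is the stopped process itself. *)
Lemma optional_stopping_le X tau j : adapted J F X ->
  integrable_process P J X -> stopping_time_in J F j tau -> (j <= J)%N ->
  (forall k, (j <= k < J)%N ->
     \forall w \ae P, (k < tau w)%N -> cond_exp P (F k) (X k.+1) w <= X k w) ->
  forall A, F j A ->
    \int[P]_(w in A) stopped X tau w <= \int[P]_(w in A) X j w.
Proof.
move=> aX iX st jJ leX A FA; rewrite (stoppedE _ _ _ st).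
have {leX} : forall k, (j <= k <= J)%N ->
    \int[P]_(w in A) X (minn (tau w) k) w <= \int[P]_(w in A) X j w; last first.
  by move/(_ J); apply; rewrite jJ leqnn.
have mA : measurable A by exact: (filtration_sub hF jJ).
elim=> [|k IH] /andP[jk kJ].
  move: jk; rewrite leqn0 => /eqP ->.
  by under eq_Rintegral do rewrite minn0.
(* The induction effectively starts at [k.+1 = j], where truncation gives the constant time [j]
   because [tau] is at least [j]. *)
move: jk; rewrite leq_eqVlt => /orP[/eqP <-|];
  last rewrite ltnS => jk.
 
  rewrite le_eqVlt; apply/orP; left; apply/eqP; apply: eq_Rintegral => w _.
  by have [/(_ w) /andP[/minn_idPr -> _] _] := st.
rewrite (Rintegral_stopped_minnS _ _ _ _ _ iX st) ?kJ ?andbT//.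
rewrite -[leRHS]addr0; apply: lerD; first by apply: IH; rewrite jk ltnW.
rewrite subr_le0.
have [_ iC _] := cond_exp_filtrationP _ _ (ltnW kJ) (iX _ kJ).
apply: ae_le_Rintegral => //.
- exact: iX (ltnW kJ).
- apply: measurableI => //; apply: (filtration_sub hF (ltnW kJ)).
  exact: stopping_time_gt st (ltnW kJ).
- have := leX k; rewrite jk kJ => /(_ isT).
  by apply: filterS => w h [_]; exact: h.
Qed.

(** The martingale property is asked only before [tau], so that the lemma applies to the value
    process, which is a martingale only up to an optimal time. *)
Lemma optional_stopping X tau j : adapted J F X ->
  integrable_process P J X -> stopping_time_in J F j tau -> (j <= J)%N ->
  (forall k, (j <= k < J)%N ->
     \forall w \ae P, (k < tau w)%N -> cond_exp P (F k) (X k.+1) w = X k w) ->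
  is_cond_exp P (F j) (stopped X tau) (X j).
Proof.
move=> aX iX st jJ eqX.
apply: is_cond_expP.
- exact: (filtration_sub hF).
- exact: integrable_stopped st.
- exact: iX.
- exact: aX.
move=> A FA; rewrite (stoppedE _ _ _ st).
have {eqX} : forall k, (j <= k <= J)%N ->
    \int[P]_(w in A) X j w = \int[P]_(w in A) X (minn (tau w) k) w; last first.
  by move/(_ J); apply; rewrite jJ leqnn.
have mA : measurable A by exact: (filtration_sub hF jJ).
elim=> [|k IH] /andP[jk kJ].
  move: jk; rewrite leqn0 => /eqP ->.
  by under [in RHS]eq_Rintegral do rewrite minn0.
move: jk; rewrite leq_eqVlt => /orP[/eqP <-|];
  last rewrite ltnS => jk.
 
  apply: eq_Rintegral => w _.
  by have [/(_ w) /andP[/minn_idPr -> _] _] := st.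
rewrite (Rintegral_stopped_minnS _ _ _ _ _ iX st) ?kJ ?andbT//.
rewrite (IH _) ?jk ?(ltnW kJ)//; apply/esym/eqP.
rewrite -subr_eq0 addrAC subrr add0r subr_eq0 eq_le.
have [_ iC _] := cond_exp_filtrationP _ _ (ltnW kJ) (iX _ kJ).
have mB : measurable (A `&` [set w | (k < tau w)%N]).
  apply: measurableI => //; apply: (filtration_sub hF (ltnW kJ)).
  exact: stopping_time_gt st (ltnW kJ).
have iXk := iX _ (ltnW kJ).
have := eqX k; rewrite jk kJ => /(_ isT) eqXk.
by apply/andP; split; apply: ae_le_Rintegral => //;
  apply: filterS eqXk => w h [_ /h ->].
Qed.

(** * First hitting times, with forced stopping at the horizon *)

Definition first_hit (Q : nat -> T -> bool) (j : nat) (w : T) : nat :=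
  [arg min_(i < (ord_max : 'I_J.+1) | (j <= i)%N && ((i == J :> nat) || Q i w))
     (i : nat)]%N.

Lemma first_hitP Q j w : (j <= J)%N ->
  [/\ (j <= first_hit Q j w <= J)%N,
      (first_hit Q j w < J)%N -> Q (first_hit Q j w) w &
      forall i, (j <= i < first_hit Q j w)%N -> ~~ Q i w].
Proof.
move=> jJ; rewrite /first_hit; case: arg_minnP => [|/= k /andP[jk Qk] kmin].
  by rewrite /= jJ eqxx.
have kJ : (k <= J)%N by rewrite -ltnS.
split; first by rewrite jk.
  by move=> ltkJ; move: Qk; rewrite (ltn_eqF ltkJ).
move=> i /andP[ji ik]; apply/negP => Qi.
have iJ : (i < J.+1)%N by rewrite ltnS (leq_trans (ltnW ik)).
have := kmin (Ordinal iJ); rewrite /= ji Qi orbT => /(_ isT).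
by rewrite leqNgt ik.
Qed.

Lemma first_hit_stopping (Q : nat -> T -> bool) j : (j <= J)%N ->
  (forall i, (i < J)%N -> F i [set w | Q i w]) ->
  stopping_time_in J F j (first_hit Q j).
Proof.
move=> jJ FQ; split=> [w|i iJ]; first by have [] := first_hitP Q j w jJ.
have sF := filtration_sigma hF iJ; apply/(measurable_sub _ sF).
have -> : [set w | (first_hit Q j w <= i)%N] =
    \bigcup_(k in [set k | (j <= k <= i)%N]) [set w | (k == J) || Q k w].
  apply/seteqP; split=> w /=.
    move=> hi; have [/andP[jh hJ] Qh _] := first_hitP Q j w jJ.
    exists (first_hit Q j w) => /=; first by rewrite jh.
    by move: hJ; rewrite leq_eqVlt => /orP[->//|/Qh ->]; rewrite orbT.
  move=> [k /= /andP[jk ki] Qk]; apply: leq_trans ki.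
  have [/andP[jh hJ] _ hmin] := first_hitP Q j w jJ.
  case/orP: Qk => [/eqP ->//|Qk]; rewrite leqNgt; apply/negP => kh.
  by have := hmin k; rewrite jk kh Qk => /(_ isT).
apply: bigcup_measurable => k /= /andP[jk ki]; apply/(measurable_sub _ sF).
(* [FQ] speaks only of times before [J]; at [k = J] the event is the whole space. *)
have [kJ|kJ] := eqVneq k J.
  have -> : [set w | true || Q k w] = setT by apply/seteqP; split.
  by apply/(measurable_sub _ sF); exact: measurableT.
apply: (filtration_mono hF (i := k)); first by rewrite ki.
by apply: FQ; rewrite ltn_neqAle kJ (leq_trans ki).
Qed.

End Filtration.

(** * The Snell envelope *)

Section SnellEnvelope.
Context {d : measure_display} {T : measurableType d} {R : realType}.
Variables (P : probability T R) (J : nat) (F : nat -> set (set T)).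
Variable Z : nat -> T -> R.
Hypotheses (hF : is_filtration J F) (aZ : adapted J F Z).
Hypothesis iZ : integrable_process P J Z.

(** Recursion on the number [k] of steps left makes backward induction in time structural. The
    resulting dynamic programming equation holds at every point, not just almost surely. *)
Fixpoint value_to_go (k : nat) : T -> R :=
  if k is k'.+1 then fun w =>
    Num.max (Z (J - k)%N w) (cond_exp P (F (J - k)%N) (value_to_go k') w)
  else Z J.

Definition value (j : nat) : T -> R := value_to_go (J - j).

Lemma value_last : value J = Z J.
Proof. by rewrite /value subnn. Qed.

Lemma value_step j w : (j < J)%N ->
  value j w = Num.max (Z j w) (cond_exp P (F j) (value j.+1) w).
Proof. by move=> jJ; rewrite /value -subnSK//= subnSK// subKn// ltnW. Qed.

(** Both properties are proved by one backward induction: integrability at [j.+1] is what makes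
    [cond_exp] at [j] a genuine conditional expectation. *)
Lemma value_regular j : (j <= J)%N ->
  sub_measurable (F j) (value j) /\ integrable_rv P (value j).
Proof.
elim: {j}(J - j)%N {-2}j (erefl (J - j)%N) => [|k IH] j Jj jJ.
  have -> : j = J by apply/eqP; rewrite eqn_leq jJ -subn_eq0 Jj.
  by rewrite value_last; split; [exact: aZ|exact: iZ].
have ltjJ : (j < J)%N by rewrite -subn_gt0 Jj.
have [mV iV] : sub_measurable (F j.+1) (value j.+1) /\
    integrable_rv P (value j.+1).
  by apply: IH => //; rewrite subnS Jj.
have [mC iC _] := cond_exp_filtrationP _ _ _ hF _ _ jJ iV.
have -> : value j = (Z j \max cond_exp P (F j) (value j.+1)).
  by apply/funext => w; exact: value_step.
split; last by apply: integrable_rv_max => //; exact: iZ.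
by apply: measurable_maxr => //; exact: aZ.
Qed.

Lemma value_adapted : adapted J F value.
Proof. by move=> j /value_regular[]. Qed.

Lemma value_integrable : integrable_process P J value.
Proof. by move=> j /value_regular[]. Qed.

Lemma le_value j w : (j <= J)%N -> Z j w <= value j w.
Proof.
rewrite leq_eqVlt => /orP[/eqP ->|jJ]; first by rewrite value_last.
by rewrite value_step// le_max lexx.
Qed.

(** [value] dominates [Z] and is a supermartingale, so optional stopping bounds the integrals of the
    stopped reward over [F j]. *)
Lemma value_ub j tau : (j <= J)%N -> stopping_time_in J F j tau ->
  \forall w \ae P, cond_exp P (F j) (stopped Z tau) w <= value j w.
Proof.
move=> jJ st; have sF := filtration_sigma hF jJ.
have iZt := integrable_stopped _ _ _ hF _ _ _ iZ st.
have iVt := integrable_stopped _ _ _ hF _ _ _ value_integrable st.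
have hC := cond_exp_filtrationP _ _ _ hF _ _ jJ iZt.
have [mC iC _] := hC.
have FT : F j setT by apply/(measurable_sub _ sF); exact: measurableT.
have : \forall w \ae P, setT w ->
    cond_exp P (F j) (stopped Z tau) w <= value j w.
  apply: (ae_le_of_Rintegral P _ sF (filtration_sub hF jJ)) => //.
  - exact: value_adapted.
  - exact: value_integrable.
  move=> D FD _; rewrite (is_cond_exp_Rintegral _ _ _ _ _ hC)//.
  apply: (@le_trans _ _ (\int[P]_(w in D) stopped value tau w)).
    apply: ae_le_Rintegral => //; first exact: (filtration_sub hF jJ).
    by apply: aeW => w _; apply: le_value; have /andP[] := st.1 w.
  apply: (optional_stopping_le _ _ _ hF) => //.
  - exact: value_adapted.
  - exact: value_integrable.
  move=> k /andP[_ kJ]; apply: aeW => w _.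
  by rewrite [leRHS]value_step// le_max lexx orbT.
by apply: filterS => w; apply.
Qed.

(** The witness is the first time from [j] on at which the reward reaches the continuation value:
    there [Z] equals [value], and strictly before it [value] has the martingale property. *)
Lemma value_attained j : (j <= J)%N -> exists2 tau, stopping_time_in J F j tau &
  \forall w \ae P, cond_exp P (F j) (stopped Z tau) w = value j w.
Proof.
move=> jJ.
pose Q i w := cond_exp P (F i) (value i.+1) w <= Z i w.
have st : stopping_time_in J F j (first_hit J Q j).
  apply: first_hit_stopping => // i iJ.
  apply: (sub_measurable_le _ (filtration_sigma hF (ltnW iJ))).
    have [] // := cond_exp_filtrationP _ _ _ hF _ _ (ltnW iJ)
      (value_integrable _ iJ).
  exact: aZ (ltnW iJ).
exists (first_hit J Q j) => //.
have ZV : stopped Z (first_hit J Q j) = stopped value (first_hit J Q j).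
  apply/funext => w; rewrite /stopped.
  have [/andP[_ hJ] hQ _] := first_hitP J Q j w jJ.
  move: hJ hQ; rewrite leq_eqVlt => /orP[/eqP ->|hJ].
    by rewrite value_last.
  by move=> /(_ hJ) hQ; rewrite [RHS]value_step// (max_idPl _).
have iVt := integrable_stopped _ _ _ hF _ _ _ value_integrable st.
rewrite ZV.
apply: (is_cond_exp_ae_eq P _ (filtration_sigma hF jJ) (filtration_sub hF jJ)
  _ _ _ _ iVt iVt).
- exact: (cond_exp_filtrationP _ _ _ hF).
- apply: (optional_stopping _ _ _ hF) => //.
  + exact: value_adapted.
  + exact: value_integrable.
  move=> k /andP[jk kJ]; apply: aeW => w kh.
  have [_ _ /(_ k)] := first_hitP J Q j w jJ.
  rewrite jk kh => /(_ isT); rewrite /Q -ltNge => /ltW hk.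
  by rewrite [RHS]value_step// (max_idPr _).
- exact: aeW.
Qed.

Let Phi j := [set cond_exp P (F j) (stopped Z tau) |
  tau in stopping_time_in J F j].

Lemma value_ess_sup j : (j <= J)%N -> is_ess_sup P (F j) (Phi j) (value j).
Proof.
move=> jJ; split; first exact: value_adapted.
  by move=> _ [tau st <-]; exact: value_ub.
move=> U mU PhiU; have [tau st eqV] := value_attained _ jJ.
have : \forall w \ae P, ((cond_exp P (F j) (stopped Z tau) w)%:E <= U w)%E.
  by apply: PhiU; exists tau.
by apply: filterS2 eqV => w ->.
Qed.

(** [value j] inhabits the set of versions, so the choice behind [snell] does not fall back on its
    default. *)
Lemma snell_ess_sup j : (j <= J)%N ->
  is_ess_sup P (F j) (Phi j) (snell P J F Z j).
Proof.
move=> jJ; apply: (xgetPex (cst 0)); exists (value j); exact: value_ess_sup.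
Qed.

(** Two essential suprema of one family bound each other almost surely. *)
Lemma snell_value j : (j <= J)%N ->
  \forall w \ae P, snell P J F Z j w = value j w.
Proof.
move=> jJ; have [mS ubS leS] := snell_ess_sup _ jJ.
have [mV ubV leV] := value_ess_sup _ jJ.
have sF := filtration_sigma hF jJ; have Fm := filtration_sub hF jJ.
have SV : \forall w \ae P, ((snell P J F Z j w)%:E <= (value j w)%:E)%E.
  apply: leS; last exact: ubV.
  by apply/measurable_EFinP; exact: sub_measurableW mV.
have VS : \forall w \ae P, ((value j w)%:E <= (snell P J F Z j w)%:E)%E.
  apply: leV; last exact: ubS.
  by apply/measurable_EFinP; exact: sub_measurableW mS.
by apply: filterS2 SV VS => w SV VS; apply/eqP; rewrite eq_le -!lee_fin SV.
Qed.

Lemma snell_adapted : adapted J F (snell P J F Z).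
Proof. by move=> j /snell_ess_sup[]. Qed.

Lemma snell_integrable : integrable_process P J (snell P J F Z).
Proof.
move=> j jJ; apply: (ae_eq_integrable_rv P (value j)).
- exact: value_integrable.
- apply: sub_measurableW (snell_adapted _ jJ).
    exact: (filtration_sigma hF).
  exact: (filtration_sub hF).
- by apply: filterS (snell_value _ jJ).
Qed.

Lemma snell_last : \forall w \ae P, snell P J F Z J w = Z J w.
Proof.
by apply: filterS (snell_value _ (leqnn J)) => w ->; rewrite value_last.
Qed.

Lemma snell_step j : (j < J)%N ->
  \forall w \ae P, snell P J F Z j w =
    Num.max (Z j w) (cond_exp P (F j) (snell P J F Z j.+1) w).
Proof.
move=> jJ.
(* Almost surely equal integrands have almost surely equal conditional expectations, which carries
   the pointwise recursion of [value] over to [snell]. *)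
have eqC : \forall w \ae P, cond_exp P (F j) (value j.+1) w =
    cond_exp P (F j) (snell P J F Z j.+1) w.
  apply: (is_cond_exp_ae_eq P _ (filtration_sigma hF (ltnW jJ))
    (filtration_sub hF (ltnW jJ)) _ _ _ _
    (value_integrable _ jJ) (snell_integrable _ jJ)).
  - exact: (cond_exp_filtrationP _ _ _ hF _ _ (ltnW jJ) (value_integrable _ jJ)).
  - exact: (cond_exp_filtrationP _ _ _ hF _ _ (ltnW jJ) (snell_integrable _ jJ)).
  - by apply: filterS (snell_value _ jJ).
apply: filterS2 eqC (snell_value _ (ltnW jJ)) => w <- ->.
by rewrite value_step.
Qed.

End SnellEnvelope.

(** * Martingales *)

Section Martingales.
Context {d : measure_display} {T : measurableType d} {R : realType}.
Variables (P : probability T R) (J : nat) (F : nat -> set (set T)).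
Hypothesis hF : is_filtration J F.
Implicit Types (X Y Z M N : nat -> T -> R) (tau : T -> nat).

Lemma martingale_is_cond_exp M i j : is_martingale P J F M ->
  (i <= j <= J)%N -> is_cond_exp P (F i) (M j) (M i).
Proof.
move=> [aM iM EM] /andP[ij jJ]; have iJ := leq_trans ij jJ.
apply: (is_cond_exp_ae P _ (filtration_sub hF iJ) _ (cond_exp P (F i) (M j))).
- exact: iM.
- exact: aM.
- exact: (cond_exp_filtrationP _ _ _ hF _ _ iJ (iM _ jJ)).
- by apply: EM; rewrite ij.
Qed.

Lemma is_martingaleP M : adapted J F M -> integrable_process P J M ->
  (forall i j, (i <= j <= J)%N -> is_cond_exp P (F i) (M j) (M i)) ->
  is_martingale P J F M.
Proof.
move=> aM iM EM; split=> // i j /andP[ij jJ]; have iJ := leq_trans ij jJ.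
apply: (is_cond_exp_ae_eq P _ (filtration_sigma hF iJ) (filtration_sub hF iJ)
  _ _ _ _ (iM _ jJ) (iM _ jJ)).
- exact: (cond_exp_filtrationP _ _ _ hF _ _ iJ (iM _ jJ)).
- by apply: EM; rewrite ij.
- exact: aeW.
Qed.

Lemma martingaleB M N : is_martingale P J F M -> is_martingale P J F N ->
  is_martingale P J F (fun j w => M j w - N j w).
Proof.
move=> hM hN; have [aM iM _] := hM; have [aN iN _] := hN.
apply: is_martingaleP.
- by move=> j jJ; apply: measurable_funB; [exact: aM|exact: aN].
- by move=> j jJ; apply: integrable_rvB; [exact: iM|exact: iN].
move=> i j ijJ; have /andP[ij jJ] := ijJ; have iJ := leq_trans ij jJ.
apply: is_cond_expB; [exact: (filtration_sub hF iJ)|exact: iM|exact: iN|..];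
  exact: martingale_is_cond_exp.
Qed.

Lemma doob_martingaleS Y j w : doob_martingale P F Y j.+1 w =
  doob_martingale P F Y j w + (Y j.+1 w - cond_exp P (F j) (Y j.+1) w).
Proof. by rewrite /doob_martingale big_nat_recr. Qed.

Lemma doob_compensatorS Y j w : doob_compensator P F Y j.+1 w =
  doob_compensator P F Y j w + (Y j w - cond_exp P (F j) (Y j.+1) w).
Proof. by rewrite /doob_compensator big_nat_recr. Qed.

(** The same version of each conditional expectation enters both sums and cancels, so the identity
    holds at every [w]. *)
Lemma doob_decomposition Y j w :
  Y j w = Y 0%N w + doob_martingale P F Y j w - doob_compensator P F Y j w.
Proof.
elim: j => [|j IH].
  by rewrite /doob_martingale /doob_compensator !big_geq// addr0 subr0.
by rewrite doob_martingaleS doob_compensatorS; lra.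
Qed.

Lemma doob_is_martingale Y : adapted J F Y -> integrable_process P J Y ->
  is_martingale P J F (doob_martingale P F Y).
Proof.
move=> aY iY; set M := doob_martingale P F Y.
have M0 : M 0%N = cst 0.
  by apply/funext => w; rewrite /M /doob_martingale big_geq.
have MS j : M j.+1 =
    fun w => M j w + (Y j.+1 w - cond_exp P (F j) (Y j.+1) w).
  by apply/funext => w; exact: doob_martingaleS.
have C j : (j < J)%N ->
    is_cond_exp P (F j) (Y j.+1) (cond_exp P (F j) (Y j.+1)).
  by move=> jJ; apply: (cond_exp_filtrationP _ _ _ hF); [exact: ltnW|exact: iY].
have iM : integrable_process P J M.
  elim=> [|j IH] jJ; first by rewrite M0; exact: integrable0.
  rewrite MS; have [_ iC _] := C _ jJ.
  by apply: integrable_rvD; [exact/IH/ltnW|apply: integrable_rvB => //; exact: iY].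
have aM : adapted J F M.
  elim=> [|j IH] jJ; first by rewrite M0; exact: measurable_cst.
  have [mC _ _] := C _ jJ; have jjJ : (j <= j.+1 <= J)%N by rewrite leqnSn.
  rewrite MS; apply: measurable_funD.
    apply: (filtration_sub_measurable _ _ hF _ _ _ jjJ).
    exact: IH (ltnW jJ).
  apply: measurable_funB; first exact: aY.
  exact: (filtration_sub_measurable _ _ hF _ _ _ jjJ).
apply: is_martingaleP => // i; elim=> [|j IH] /andP[ij jJ].
  move: ij; rewrite leqn0 => /eqP ->.
  by apply: is_cond_exp_id; [exact: (filtration_sub hF)|exact: iM|exact: aM].
have iJ := leq_trans ij jJ.
move: ij; rewrite leq_eqVlt => /orP[/eqP ->|]; last rewrite ltnS => ij.
  by apply: is_cond_exp_id; [exact: (filtration_sub hF)|exact: iM|exact: aM].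
apply: is_cond_expP; [exact: (filtration_sub hF)|exact: iM|exact: iM|exact: aM|].
move=> D FD; have mD := filtration_sub hF iJ FD; have [_ iC _] := C _ jJ.
rewrite MS RintegralD//; last 2 first.
- by apply: integrable_rvS => //; apply: iM; exact: ltnW.
- by apply: integrable_rvS => //; apply: integrable_rvB => //; exact: iY.
rewrite RintegralB//; last 2 first.
- by apply: integrable_rvS => //; exact: iY.
- exact: integrable_rvS.
(* [D] also belongs to the later [F j], so [Y j.+1] and its conditional expectation have equal
   integrals over [D] and the increment contributes nothing. *)
have FjD : F j D.
  by apply: (filtration_mono hF (i := i)) => //; rewrite ij (ltnW jJ).
rewrite (is_cond_exp_Rintegral _ _ _ _ _ (C _ jJ))// subrr addr0.
apply: (is_cond_exp_Rintegral _ _ _ _ _ _ FD).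
by apply: IH; rewrite ij (ltnW jJ).
Qed.

(** Optional stopping from [j] needs a time with values at least [j]; this one coincides with [tau]
    on the event [j <= tau]. *)
Lemma stopping_time_maxn tau j : stopping_time_in J F 0 tau -> (j <= J)%N ->
  stopping_time_in J F j (fun w => maxn (tau w) j).
Proof.
move=> [tauJ mtau] jJ; split=> [w|i iJ].
  by rewrite leq_maxr geq_max jJ andbT; have /andP[] := tauJ w.
have [ji|ij] := leqP j i.
  have -> : [set w | (maxn (tau w) j <= i)%N] = [set w | (tau w <= i)%N].
    by apply/seteqP; split=> w /=; rewrite geq_max ji andbT.
  exact: mtau.
have -> : [set w | (maxn (tau w) j <= i)%N] = set0.
  by apply/seteqP; split=> w //=; rewrite geq_max (leqNgt j) ij andbF.
by have [] := filtration_sigma hF iJ.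
Qed.

Lemma stopping_time_ge tau j : stopping_time_in J F 0 tau -> (j <= J)%N ->
  F j [set w | (j <= tau w)%N].
Proof.
move=> st; case: j => [|j] jJ.
  have -> : [set w | (0 <= tau w)%N] = setT by apply/seteqP; split.
  apply/(measurable_sub _ (filtration_sigma hF jJ)); exact: measurableT.
apply: (filtration_mono hF (i := j)); first by rewrite leqnSn.
by apply: (stopping_time_gt _ _ hF _ _ _ st); exact: ltnW.
Qed.

Lemma martingale_stopped M tau j : is_martingale P J F M ->
  stopping_time_in J F j tau -> (j <= J)%N ->
  is_cond_exp P (F j) (stopped M tau) (M j).
Proof.
move=> [aM iM EM] st jJ; apply: (optional_stopping _ _ _ hF) => //.
move=> k /andP[jk kJ]; have := EM k k.+1; rewrite leqnSn kJ => /(_ isT).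
by apply: filterS => w.
Qed.

End Martingales.

Lemma pathwise_max_leP {d} {T : measurableType d} {R : realType} J
    (Z M : nat -> T -> R) w c :
  pathwise_max J Z M w <= c <->
  forall r, (r <= J)%N -> Z r w - M r w <= c.
Proof.
rewrite /pathwise_max big_mkord; split=> [/bigmax_leP[_ H] r rJ|H].
  by have := H (Ordinal (rJ : (r < J.+1)%N)) isT.
(* The default of the maximum is the term [r = 0], so [H] bounds it too. *)
by apply/bigmax_leP; split=> [|i _]; apply: H => //; rewrite -ltnS.
Qed.

(** The default [-oo] lies below 0, so for [j = 0] both sides hold. *)
Lemma bigmaxe_le0P {R : realType} (f : nat -> R) j :
  (\big[maxe/-oo]_(0 <= r < j) (f r)%:E <= 0)%E <->
  forall r, (r < j)%N -> f r <= 0.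
Proof.
rewrite big_mkord; split=> [/bigmax_leP[_ H] r rj|H].
  by have := H (Ordinal rj) isT; rewrite lee_fin.
by apply/bigmax_leP; split=> [|i _]; rewrite ?leNye// lee_fin; exact: H.
Qed.

(** * Optimal dual martingales *)

Section Optimality.
Context {d : measure_display} {T : measurableType d} {R : realType}.
Variables (P : probability T R) (J : nat) (F : nat -> set (set T)).
Variables (Z S : nat -> T -> R).
Hypotheses (hF : is_filtration J F) (aZ : adapted J F Z).
Hypotheses (iZ : integrable_process P J Z) (mS : is_martingale P J F S).
Hypothesis S0 : \forall w \ae P, S 0%N w = 0.

Let Y := snell P J F Z.
Let A := doob_compensator P F Y.
Let tau := first_optimal P J F Z.
Let M := fun j w => doob_martingale P F Y j w - S j w.

Let aY : adapted J F Y. Proof. exact: snell_adapted. Qed.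
Let iY : integrable_process P J Y. Proof. exact: snell_integrable. Qed.
Let aS := martingale_adapted mS.
Let iS := martingale_integrable mS.
Let sF0 : sigma_algebra setT (F 0%N).
Proof. exact: (filtration_sigma hF). Qed.
Let Fm0 : F 0%N `<=` measurable.
Proof. exact: (filtration_sub hF). Qed.

(** Holds by conversion: the guard [0 <= i] in [first_hit] computes to true. *)
Let tauE : tau =
  first_hit J (fun i w => cond_exp P (F i) (Y i.+1) w <= Z i w) 0.
Proof. by []. Qed.

Lemma first_optimal_le w : (tau w <= J)%N.
Proof.
rewrite tauE; have [/andP[_ h] _ _] := first_hitP J (fun i w =>
  cond_exp P (F i) (Y i.+1) w <= Z i w) 0 w (leq0n J).
exact: h.
Qed.

Lemma first_optimal_stopping : stopping_time_in J F 0 tau.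
Proof.
rewrite tauE; apply: first_hit_stopping => // i iJ.
apply: (sub_measurable_le _ (filtration_sigma hF (ltnW iJ))).
  by have [] // := cond_exp_filtrationP _ _ _ hF _ _ (ltnW iJ) (iY _ iJ).
exact: aZ (ltnW iJ).
Qed.

(** Collects the dynamic programming equations outside a single null set. Before [tau] the
    continuation value exceeds the reward, so [Y] equals it and the increments of [A] vanish. *)
Lemma snell_pathwise : \forall w \ae P,
  [/\ forall j, (j <= J)%N -> Z j w <= Y j w,
      Y (tau w) w = Z (tau w) w &
      forall j, (j <= tau w)%N -> A j w = 0].
Proof.
have step : \forall w \ae P, forall j, (j < J)%N ->
    Y j w = Num.max (Z j w) (cond_exp P (F j) (Y j.+1) w).
  apply: ae_foralln => j; have [jJ|_] := ltnP j J; last exact: aeW.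
  by apply: filterS (snell_step P J F Z hF aZ iZ _ jJ).
have last : \forall w \ae P, Y J w = Z J w by exact: snell_last.
apply: filterS2 step last => w {}step {}last.
have [/andP[_ tauJ] tauQ tau_min] := first_hitP J (fun i w =>
  cond_exp P (F i) (Y i.+1) w <= Z i w) 0 w (leq0n J).
rewrite -tauE in tauJ tauQ tau_min.
split.
- move=> j; rewrite leq_eqVlt => /orP[/eqP ->|jJ]; first by rewrite last.
  by rewrite step// le_max lexx.
- move: tauJ tauQ; rewrite leq_eqVlt => /orP[/eqP ->//|tauJ] /(_ tauJ) tauQ.
  by rewrite step// (max_idPl tauQ).
elim=> [|j IH] jtau; first by rewrite /A /doob_compensator big_geq.
rewrite /A doob_compensatorS -/(A j w) IH ?(ltnW jtau)// add0r.
rewrite step ?(leq_trans jtau)//.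
have := tau_min j; rewrite jtau => /(_ isT); rewrite -ltNge => /ltW /max_idPr ->.
by rewrite subrr.
Qed.

Lemma reward_minus_martingale j w :
  Z j w - M j w = Y 0%N w + S j w - (Y j w - Z j w + A j w).
Proof. by have := doob_decomposition P F Y j w; rewrite /M /A; lra. Qed.

Lemma dual_martingale0 : martingale0 P J F M.
Proof.
split; first by apply: martingaleB => //; exact: doob_is_martingale.
apply: filterS S0 => w S0w.
by rewrite /M S0w /doob_martingale big_geq// subr0.
Qed.

Lemma integrable_pathwise_max : integrable_rv P (pathwise_max J Z M).
Proof.
have [[_ iM _] _] := dual_martingale0.
have iZM j : (j <= J)%N -> integrable_rv P (fun w => Z j w - M j w).
  by move=> jJ; apply: integrable_rvB; [exact: iZ|exact: iM].
apply: integrable_rv_bigmax => [|r]; first exact: iZM.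
by rewrite mem_index_iota => /andP[_ rJ]; exact: iZM.
Qed.

(** Almost surely this is the term [r = tau] of the pathwise maximum. *)
Let Ntau w := Y 0%N w + stopped S tau w.

Let iStau : integrable_rv P (stopped S tau).
Proof. exact: integrable_stopped first_optimal_stopping. Qed.

Let iNtau : integrable_rv P Ntau.
Proof. by apply: integrable_rvD => //; exact: iY. Qed.

Lemma is_cond_exp_Ntau : is_cond_exp P (F 0%N) Ntau (Y 0%N).
Proof.
apply: (is_cond_exp_ae P _ Fm0 _ (fun w => Y 0%N w + S 0%N w)).
- exact: iY.
- exact: aY.
- apply: is_cond_expD => //; first exact: iY.
    by apply: is_cond_exp_id => //; [exact: iY|exact: aY].
  exact: martingale_stopped first_optimal_stopping _.
- by apply: filterS S0 => w ->; rewrite addr0.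
Qed.

Lemma Ntau_le_pathwise_max : \forall w \ae P, Ntau w <= pathwise_max J Z M w.
Proof.
apply: filterS snell_pathwise => w [_ Ytau A0].
have /pathwise_max_leP /(_ _ (first_optimal_le w)) := lexx (pathwise_max J Z M w).
by apply: le_trans; rewrite reward_minus_martingale Ytau A0// /Ntau /stopped; lra.
Qed.

(** [Ntau] never exceeds the maximum, up to a null set, and its [F 0]-conditional expectation is
    [Y 0]. Weak optimality makes the two expectations equal, which forces almost sure equality. *)
Lemma weakly_optimalP : weakly_optimal P J F Z M <->
  \forall w \ae P, pathwise_max J Z M w <= Ntau w.
Proof.
have iX := integrable_pathwise_max.
have CX := cond_exp_filtrationP P J F hF 0 _ (leq0n J) iX.
split=> [[_ opt]|le].
  have FT : F 0%N setT by apply/(measurable_sub _ sF0); exact: measurableT.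
  have eqX : \forall w \ae P, setT w -> Ntau w = pathwise_max J Z M w.
    apply: ae_eq_of_le_Rintegral => //.
      by apply: filterS Ntau_le_pathwise_max.
    rewrite -(is_cond_exp_Rintegral _ _ _ _ _ CX FT).
    rewrite -(is_cond_exp_Rintegral _ _ _ _ _ is_cond_exp_Ntau FT).
    have [_ iC _] := CX.
    apply: ae_le_Rintegral => //; first exact: iY.
    by apply: filterS opt => w /esym opt _; rewrite opt.
  by apply: filterS eqX => w ->.
split; first exact: dual_martingale0.
apply: (is_cond_exp_ae_eq P _ sF0 Fm0 _ _ _ _ iNtau iX is_cond_exp_Ntau CX).
by apply: filterS2 Ntau_le_pathwise_max le => w h1 h2;
  apply/eqP; rewrite eq_le h1.
Qed.

Lemma martingale_on_stopping j : (j <= J)%N ->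
  is_cond_exp P (F j) (stopped S (fun w => maxn (tau w) j)) (S j).
Proof.
move=> jJ; apply: (martingale_stopped _ _ _ hF) => //.
by apply: (stopping_time_maxn _ _ hF) => //; exact: first_optimal_stopping.
Qed.

Lemma integrable_on_stopping j : (j <= J)%N ->
  integrable_rv P (stopped S (fun w => maxn (tau w) j)).
Proof.
move=> jJ; apply: (integrable_stopped _ _ _ hF _ _ j) => //.
by apply: (stopping_time_maxn _ _ hF) => //; exact: first_optimal_stopping.
Qed.

(* Optional sampling transports an F_j-measurable lower bound of S at tau to
   S_j on the event that tau has not occurred before j. *)
Lemma le_martingale_before_stopping j (X : T -> R) : (j <= J)%N ->
  sub_measurable (F j) X -> integrable_rv P X ->
  (\forall w \ae P, (j <= tau w)%N -> X w <= S (tau w) w) ->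
  \forall w \ae P, (j <= tau w)%N -> X w <= S j w.
Proof.
move=> jJ mX iX leX.
apply: (is_cond_exp_local_le P _ (filtration_sigma hF jJ)
  (filtration_sub hF jJ) _ _ _ _ [set w | (j <= tau w)%N] iX
  (integrable_on_stopping _ jJ) _ (martingale_on_stopping _ jJ)).
- by apply: is_cond_exp_id => //; exact: (filtration_sub hF).
- by apply: (stopping_time_ge _ _ hF) => //; exact: first_optimal_stopping.
- apply: filterS leX => w leX /= jtau.
  by rewrite /stopped (maxn_idPl jtau); exact: leX.
Qed.

(** [S j] is the conditional expectation of [S] at [maxn tau j], which vanishes on the event
    [j <= tau] of [F j]; localised comparison with the zero function concludes. *)
Lemma martingale_before_stopping_eq0 j : (j <= J)%N ->
  (\forall w \ae P, S (tau w) w = 0) ->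
  \forall w \ae P, (j <= tau w)%N -> S j w = 0.
Proof.
move=> jJ St0.
apply: (is_cond_exp_local_eq P _ (filtration_sigma hF jJ)
  (filtration_sub hF jJ) _ (cst 0) _ (cst 0) [set w | (j <= tau w)%N]
  (integrable_on_stopping _ jJ) _ (martingale_on_stopping _ jJ)).
- exact: integrable0.
- apply: is_cond_exp_id; first exact: (filtration_sub hF).
    exact: integrable0.
  exact: measurable_cst.
- by apply: (stopping_time_ge _ _ hF) => //; exact: first_optimal_stopping.
- by apply: filterS St0 => w St0 /= jtau; rewrite /stopped (maxn_idPl jtau).
Qed.

Lemma weakly_optimal_iff : weakly_optimal P J F Z M <->
  \forall w \ae P,
    (forall j, (j <= tau w)%N ->
       (\big[maxe/-oo]_(0 <= r < j)
          (Z r w - Y r w - S j w + S r w)%:E <= 0)%E) /\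
    (forall j, (tau w < j <= J)%N ->
       S j w - S (tau w) w <= Y j w - Z j w + A j w).
Proof.
apply: (iff_trans weakly_optimalP); split=> [opt|cond]; last first.
  apply: filterS2 cond snell_pathwise => w [before after] [ZY Ytau A0].
  apply/pathwise_max_leP => r rJ.
  rewrite reward_minus_martingale /Ntau /stopped.
  have [rtau|taur|->] := ltngtP r (tau w).
  (* Terms before [tau] are controlled by the first condition at [j = tau]. *)
  - have /(bigmaxe_le0P (fun r => Z r w - Y r w - S (tau w) w + S r w)) :=
      before _ (leqnn _).
    by move=> /(_ _ rtau); rewrite A0 ?(ltnW rtau)//; lra.
  - by have := after r; rewrite taur rJ => /(_ isT); lra.
  - by rewrite Ytau A0//; lra.
have {opt} opt : \forall w \ae P, forall r, (r <= J)%N ->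
    S r w - (Y r w - Z r w + A r w) <= S (tau w) w.
  apply: filterS opt => w /pathwise_max_leP opt r /opt.
  by rewrite reward_minus_martingale /Ntau /stopped; lra.
(* For [r < j] the left side is [F j]-measurable, and [opt] bounds it by [S] at [tau] because [A r]
   vanishes there; conditioning on [F j] moves the bound from [tau] to [j]. Countably many pairs
   share one null set. *)
have before : \forall w \ae P, forall j r, (r < j)%N -> (j <= tau w)%N ->
    Z r w - Y r w + S r w <= S j w.
  apply: ae_foralln => j; apply: ae_foralln => r.
  have [rj|_] := ltnP r j; last exact: aeW.
  have [jJ|Jj] := leqP j J; last first.
    by apply: aeW => w _ /leq_trans /(_ (first_optimal_le w)); rewrite leqNgt Jj.
  have rjJ : (r <= j <= J)%N by rewrite (ltnW rj).
  have rJ := leq_trans (ltnW rj) jJ.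
  have mono X : adapted J F X -> sub_measurable (F j) (X r).
    by move=> aX; apply: (filtration_sub_measurable _ _ hF _ _ _ rjJ); exact: aX.
  have : \forall w \ae P, (j <= tau w)%N -> Z r w - Y r w + S r w <= S j w.
    apply: le_martingale_before_stopping => //.
    - apply: measurable_funD; last exact: mono.
      by apply: measurable_funB; exact: mono.
    - apply: integrable_rvD; last exact: iS.
      by apply: integrable_rvB; [exact: iZ|exact: iY].
    apply: filterS2 opt snell_pathwise => w /(_ r rJ) opt [_ _ A0] jtau.
    by move: opt; rewrite A0 ?(leq_trans (ltnW rj))//; lra.
  by apply: filterS => w h _.
apply: filterS2 opt before => w opt before; split=> [j jtau|j /andP[tauj jJ]].
  apply/(bigmaxe_le0P (fun r => Z r w - Y r w - S j w + S r w)) => r rj.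
  by have := before _ _ rj jtau; lra.
by have := opt _ jJ; lra.
Qed.

Lemma surely_optimal_iff : surely_optimal P J F Z M <->
  \forall w \ae P,
    (forall j, (j <= tau w)%N -> S j w = 0) /\
    (forall j, (tau w < j <= J)%N -> S j w <= Y j w - Z j w + A j w).
Proof.
split=> [[_ opt]|cond]; last first.
  split; first exact: dual_martingale0.
  have NX := Ntau_le_pathwise_max.
  apply: filterS3 NX cond snell_pathwise => w NX [before after] [ZY Ytau A0].
  apply/eqP; rewrite eq_le; apply/andP; split.
    by move: NX; rewrite /Ntau /stopped before// addr0.
  apply/pathwise_max_leP => r rJ; rewrite -/Y reward_minus_martingale.
  have [rtau|taur] := leqP r (tau w).
    by have := ZY _ rJ; rewrite A0// before//; lra.
  by have := after r; rewrite taur rJ => /(_ isT); lra.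
have {opt} opt : \forall w \ae P, forall r, (r <= J)%N ->
    S r w <= Y r w - Z r w + A r w.
  apply: filterS opt => w opt r rJ.
  have : pathwise_max J Z M w <= Y 0%N w by rewrite -opt.
  by move=> /pathwise_max_leP /(_ _ rJ); rewrite reward_minus_martingale; lra.
(* At [r = tau] the right side of [opt] is zero, so [S] at [tau] is non-positive; its expectation is
   that of [S 0], which is zero, so it vanishes almost surely. *)
have St0 : \forall w \ae P, S (tau w) w = 0.
  have : \forall w \ae P, setT w -> stopped S tau w = cst 0 w.
    apply: ae_eq_of_le_Rintegral => //; first exact: integrable0.
      apply: filterS2 opt snell_pathwise => w /(_ _ (first_optimal_le w)).
      by rewrite /stopped => opt [_ Ytau A0] _; move: opt;
        rewrite Ytau A0// subrr add0r.
    have FT : F 0%N setT by apply/(measurable_sub _ sF0); exact: measurableT.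
    rewrite -(is_cond_exp_Rintegral _ _ _ _ _
      (martingale_stopped _ _ _ hF _ _ _ mS first_optimal_stopping (leq0n J)) FT).
    apply: ae_le_Rintegral => //; [exact: integrable0|exact: iS|].
    by apply: filterS S0 => w ->.
  by apply: filterS => w; apply.
have before : \forall w \ae P, forall j, (j <= tau w)%N -> S j w = 0.
  apply: ae_foralln => j; have [jJ|Jj] := leqP j J.
    exact: martingale_before_stopping_eq0.
  by apply: aeW => w /leq_trans /(_ (first_optimal_le w)); rewrite leqNgt Jj.
apply: filterS2 opt before => w opt before; split=> // j /andP[_ jJ].
exact: opt.
Qed.

End Optimality.

Theorem theorem2p9 (d : measure_display) (T : measurableType d) (R : realType)
    (P : probability T R) (J : nat) (F : nat -> set (set T))
    (Z S : nat -> T -> R)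
    (J_gt0 : (0 < J)%N)
    (F_filtration : is_filtration J F)
    (Z_adapted : adapted J F Z)
    (Z_integrable : integrable_process P J Z)
    (S_martingale : is_martingale P J F S)
    (S_0 : \forall w \ae P, S 0%N w = 0) :
  let Y := snell P J F Z in
  let Mstar := doob_martingale P F Y in
  let A := doob_compensator P F Y in
  let tau := first_optimal P J F Z in
  let M := fun j w => Mstar j w - S j w in
  [/\ \forall w \ae P, forall j, (j <= tau w)%N -> A j w = 0,
      weakly_optimal P J F Z M <->
        \forall w \ae P,
          (forall j, (j <= tau w)%N ->
             (\big[maxe/-oo]_(0 <= r < j)
                (Z r w - Y r w - S j w + S r w)%:E <= 0)%E) /\
          (forall j, (tau w < j <= J)%N ->
             S j w - S (tau w) w <= Y j w - Z j w + A j w)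
    & surely_optimal P J F Z M <->
        \forall w \ae P,
          (forall j, (j <= tau w)%N -> S j w = 0) /\
          (forall j, (tau w < j <= J)%N ->
             S j w <= Y j w - Z j w + A j w)].
Proof.
split.
- by apply: filterS (snell_pathwise P J F Z F_filtration Z_adapted
    Z_integrable) => w [].
- exact: weakly_optimal_iff.
- exact: surely_optimal_iff.
Qed.
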